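(* Let $n\ge2$, $1\le p\le n$ and $1\le r\le n+1$. If $r\le n-p+1$ and $p\le n-1$, then $|\mathcal{T}_n^{(r,p)}|=\sum_{i=r}^{n}|\mathcal{T}_{n-1}^{(i,p)}|$. If $r>n-p+1$ and $p\ge2$, then $|\mathcal{T}_n^{(r,p)}|=\sum_{i=1}^{r-1}|\mathcal{T}_{n-1}^{(i,p-1)}|$.
   Context: For $m\ge1$, $1\le p\le m$: sites are $0,\dots,m+1$; a configuration in $\mathcal{S}(m,p)$ places $m+1$ distinct chips labeled $1,\dots,m+1$ with sites $0,m+1$ empty, one chip at each site of $\{1,\dots,m\}\setminus\{p\}$ and two chips at site $p$. Toppling: while some site holds at least two chips, choose such a site $i$ and two chips $\alpha<\beta$ there and move $\alpha$ to $i-1$, $\beta$ to $i+1$; it is known this terminates with at most one chip per site and the final configuration is independent of the choices. For $\pi\in S_m$, $r\in[m+1]$, $\pi^{(r,p)}$ places at site $i$ ($1\le i\le m$) chip $\pi_i$ if $\pi_i<r$ and $\pi_i+1$ otherwise, plus chip $r$ at site $p$. $\mathcal{T}_m^{(r,p)}$ is the set of $\pi\in S_m$ such that the final configuration of $\pi^{(r,p)}$, read left to right, is $1,2,\dots,m+1$. *)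

(* Defs.v *)
From HB Require Import structures.
From mathcomp Require Import all_boot all_order all_algebra all_fingroup.
From mathcomp Require Import boolp.
From Stdlib Require Import Relations.
Set Implicit Arguments. Unset Strict Implicit. Unset Printing Implicit Defensive.
Import Order.TTheory GRing.Theory Num.Theory.

(* A configuration with chips labeled 1..m+1 is a position function:
   chip k (1 <= k <= m+1) sits at site (c k : int).  Values of c outside
   1..m+1 are irrelevant. *)
Definition config := nat -> int.

Local Open Scope ring_scope.

Definition topple (m : nat) (c c' : config) : Prop :=
  exists a b : nat, [/\ (1 <= a)%N, (a < b)%N, (b <= m.+1)%N, c a = c b &
    c' = (fun k => if k == a then c a - 1 else if k == b then c a + 1 else c k)].

Definition stable (m : nat) (c : config) : Prop :=
  forall a b : nat, (1 <= a)%N -> (a < b)%N -> (b <= m.+1)%N -> c a <> c b.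

Definition final (m : nat) (c c' : config) : Prop :=
  clos_refl_trans config (topple m) c c' /\ stable m c'.

Definition reads_identity (m : nat) (c : config) : Prop :=
  (forall k : nat, (1 <= k <= m.+1)%N -> 0 <= c k <= (m.+1)%:Z) /\
  (forall a b : nat, (1 <= a)%N -> (a < b)%N -> (b <= m.+1)%N -> c a < c b).

(* Chip placed at site i+1 (for i : 'I_m) in pi^{(r,p)}. *)
Definition chip_at (m r : nat) (pi : 'S_m) (i : 'I_m) : nat :=
  let v := (val (pi i)).+1 in if (v < r)%N then v else v.+1.

Definition init (m r p : nat) (pi : 'S_m) : config :=
  fun k => if k == r then (p%:Z)
           else ((find (fun i : 'I_m => chip_at r pi i == k) (enum 'I_m)).+1)%:Z.

Definition calT (m r p : nat) : {set 'S_m} :=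
  [set pi : 'S_m | `[< exists c', final m (init r p pi) c' /\ reads_identity m c' >]].

(* Main.v *)
Require Import Defs.
From HB Require Import structures.
From mathcomp Require Import all_boot all_order all_algebra all_fingroup.
From mathcomp Require Import zify boolp.
From Stdlib Require Import Relations.

Set Implicit Arguments. Unset Strict Implicit. Unset Printing Implicit Defensive.
Import Order.TTheory GRing.Theory Num.Theory.

(* Toppling p, p-1, ..., 1, then p+1, p, ..., 2, and so on up to n, ..., n-p+1
   stabilizes the configuration. On the word pi_1 .. pi_p r pi_(p+1) .. pi_n
   this is a sequence of bubble passes: the t-th one carries the minimum of the
   window t, ..., t+p to the front of the window. Since no reachable
   configuration has three chips on a site, toppling is confluent, so the size
   of T_n^(r,p) is the number N(n,p,r) of words on 1, ..., n+1 with letter r at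
   position p+1 that are sorted by these passes.

   For r <= n-p the first r+1 windows exist. In a sorted word the letter r is
   emitted by pass r, so it starts in the first p+r positions, and r+1 starts in
   the first p+r+1. If r+1 starts in the first p+r positions, then r and r+1 are
   compared at some point, so exchanging them does not affect the outcome. If
   r+1 starts at position p+r+1, it enters the window for pass r+1 and is
   emitted at once, so it can be deleted. Hence
   N(n,p,r) = N(n,p,r+1) + N(n-1,p,r). With N(n,p,1) = sum_i N(n-1,p,i) (delete
   the letter 1) this yields the first formula, and the reflection of sites and
   labels turns it into the second one. *)

(** * Bubble passes *)

(* [bmin O x] and [bout O x] are the minimum carried out of a pass and the
   letters left behind; the window reads [rev O] followed by [x]. *)
Fixpoint bmin (O : seq nat) (x : nat) : nat :=
  if O is y :: O' then bmin O' (minn x y) else x.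

Fixpoint bout (O : seq nat) (x : nat) : seq nat :=
  if O is y :: O' then maxn x y :: bout O' (minn x y) else [::].

(** [O] holds the window without its incoming letter, rightmost letter first. Once [s] is exhausted,
    the rest of the window is read from left to right. *)
Fixpoint run (O s : seq nat) : seq nat :=
  if s is x :: s' then bmin O x :: run (bout O x) s' else rev O.

Lemma perm_bub O x : perm_eq (bmin O x :: bout O x) (x :: O).
Proof.
elim: O x => [//|y O IH] x /=.
rewrite (perm_catCA [:: _] [:: _] (bout O (minn x y))) /=.
apply: (@perm_trans _ (maxn x y :: minn x y :: O)); first by rewrite perm_cons.
case: (leqP x y) => _; last by [].
by rewrite (perm_catCA [:: y] [:: x] O).
Qed.

Lemma size_bout O x : size (bout O x) = size O.
Proof. by elim: O x => //= y O IH x; rewrite IH. Qed.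

Lemma mem_bub O x : bmin O x :: bout O x =i x :: O.
Proof. exact: perm_mem (perm_bub O x). Qed.

Lemma bmin_mem O x : bmin O x \in x :: O.
Proof. by rewrite -mem_bub mem_head. Qed.

Lemma bout_sub O x : {subset bout O x <= x :: O}.
Proof. by move=> y yO; rewrite -mem_bub inE yO orbT. Qed.

Lemma perm_run O s : perm_eq (run O s) (O ++ s).
Proof.
elim: s O => [|x s IH] O /=; first by rewrite cats0 perm_rev.
rewrite perm_sym (perm_catCA O [:: x] s) /= perm_sym.
apply: (@perm_trans _ (bmin O x :: bout O x ++ s)); first by rewrite perm_cons IH.
by rewrite -(cat_cons _ _ s) -(cat_cons _ _ s) perm_cat2r perm_bub.
Qed.

Lemma size_run O s : size (run O s) = size (O ++ s).
Proof. exact/perm_size/perm_run. Qed.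

Lemma bmin_le O x : {in x :: O, forall y, bmin O x <= y}.
Proof.
elim: O x => [|z O IH] x y /=; first by rewrite inE => /eqP ->.
have IH0 : bmin O (minn x z) <= minn x z by apply: IH; rewrite mem_head.
rewrite !inE => /or3P[/eqP ->|/eqP ->|yO]; [lia | lia |].
by apply: IH; rewrite inE yO orbT.
Qed.

Lemma bmin_min O x : {in O, forall y, x <= y} -> bmin O x = x.
Proof.
elim: O => //= y O IH H; have xy : x <= y by apply: H; rewrite mem_head.
by rewrite (minn_idPl xy) IH // => z zO; apply: H; rewrite inE zO orbT.
Qed.

Lemma bout_min O x : {in O, forall y, x <= y} -> bout O x = O.
Proof.
elim: O => //= y O IH H; have xy : x <= y by apply: H; rewrite mem_head.
rewrite (minn_idPl xy) (maxn_idPr xy) IH // => z zO.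
by apply: H; rewrite inE zO orbT.
Qed.

Section Monotone.
Variable f : nat -> nat.
Hypothesis f_mono : {mono f : x y / x <= y}.

Let f_min x y : minn (f x) (f y) = f (minn x y).
Proof. by have := f_mono x y; have := f_mono y x; case: (leqP x y); lia. Qed.

Let f_max x y : maxn (f x) (f y) = f (maxn x y).
Proof. by have := f_mono x y; have := f_mono y x; case: (leqP x y); lia. Qed.

Lemma bmin_map O x : bmin (map f O) (f x) = f (bmin O x).
Proof. by elim: O x => //= y O IH x; rewrite f_min IH. Qed.

Lemma bout_map O x : bout (map f O) (f x) = map f (bout O x).
Proof. by elim: O x => //= y O IH x; rewrite f_min f_max IH. Qed.

Lemma run_map O s : run (map f O) (map f s) = map f (run O s).
Proof. by elim: s O => /= [|x s IH] O; rewrite ?map_rev // bmin_map bout_map IH. Qed.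
End Monotone.

Lemma bump_mono h : {mono bump h : x y / x <= y}.
Proof. by move=> x y; rewrite leq_bump2. Qed.

Lemma bump_inj h : injective (bump h).
Proof. exact: can_inj (bumpK h). Qed.

Lemma map_bump_iota u N : map (bump u) (iota u N) = iota u.+1 N.
Proof.
rewrite -[u.+1]add1n iotaDl; apply/eq_in_map => i.
by rewrite mem_iota /bump => /andP[-> _].
Qed.

(** A letter [u] entering a window with no smaller letter is emitted at once and leaves the window
    unchanged. Either equation forces the window letters to be at least [u], since the result
    contains them all. *)
Lemma run_insert_head u O s N :
  (run (map (bump u) O) (u :: map (bump u) s) == iota u N.+1) =
  (run O s == iota u N).
Proof.
have key : {in map (bump u) O, forall y, u <= y} ->
  (run (map (bump u) O) (u :: map (bump u) s) == iota u N.+1) =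
  (run O s == iota u N).
  move=> H; rewrite /= bmin_min // bout_min // run_map; last exact: bump_mono.
  by rewrite eqseq_cons eqxx /= -map_bump_iota (inj_eq (inj_map (@bump_inj u))).
apply/idP/idP => /eqP E.
- rewrite -key ?E // => y yO.
  have := perm_mem (perm_run (map (bump u) O) (u :: map (bump u) s)) y.
  by rewrite E mem_cat yO mem_iota /=; lia.
- rewrite key ?E // => _ /mapP[y yO ->].
  have := perm_mem (perm_run O s) y.
  by rewrite E mem_cat yO mem_iota /bump /=; lia.
Qed.

(** The letters of [s1] feed the passes that have to emit [t], ..., [r]. These passes are not
    disturbed, as [bump r.+1] is monotone and fixes every letter up to [r]. Then [r.+1] enters in
    the very pass that has to emit it. *)
Lemma run_insert t r O s1 s2 N : t <= r -> size s1 = (r - t).+1 ->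
  (run (map (bump r.+1) O) (map (bump r.+1) s1 ++ r.+1 :: map (bump r.+1) s2)
     == iota t N.+1) = (run O (s1 ++ s2) == iota t N).
Proof.
elim: s1 t N O => [//|x s1 IH] t N O tr /= [sz].
have f_mono := bump_mono r.+1.
case: N => [|N].
  (* Both equations fail by length: each result is longer than the [iota] it is compared with. *)
  apply/negbTE/eqP => -[_] /(f_equal size).
  by rewrite size_run !size_cat /= !addnS.
rewrite /= -/(iota t.+1 N.+1) !eqseq_cons bmin_map // bout_map //.
have -> : (bump r.+1 (bmin O x) == t) = (bmin O x == t).
  by rewrite /bump; case: leqP; lia.
congr (_ && _).
move: tr; rewrite leq_eqVlt => /orP[/eqP tr|tr]; last by apply: IH; lia.
case: s1 sz {IH} => [_|? ?] /=; last by rewrite tr subnn.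
by rewrite -tr; apply: run_insert_head.
Qed.

(** A pass emits only a letter of its window, and up to the pass emitting [t + j] only [O] and the
    first [j.+1] letters of [s] have entered. *)
Lemma run_iota_mem t O s j : run O s = iota t (size (O ++ s)) -> j < size s ->
  t + j \in O ++ take j.+1 s.
Proof.
elim: s t O j => [//|x s IH] t O j /=.
rewrite size_cat /= addnS => -[E1 E2] js.
case: j js => [|j] js.
  by rewrite addn0 -E1 take0 mem_cat inE orbC -in_cons bmin_mem.
have := IH t.+1 (bout O x) j.
rewrite E2 size_cat size_bout => /(_ erefl js); rewrite addSnnS.
rewrite !mem_cat inE => /orP[/bout_sub|->]; last by rewrite !orbT.
by rewrite inE => /orP[->|->]; rewrite ?orbT.
Qed.

Definition swap_succ (r k : nat) : nat :=
  if k == r then r.+1 else if k == r.+1 then r else k.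

Lemma swap_succK r : involutive (swap_succ r).
Proof. by move=> k; rewrite /swap_succ; do !case: eqP => //; lia. Qed.

Lemma map_swap_id r s : r \notin s -> r.+1 \notin s -> map (swap_succ r) s = s.
Proof.
move=> h1 h2; rewrite -[RHS]map_id; apply/eq_in_map => k ks.
by rewrite /swap_succ !ifN //; [apply: contraNneq h2 => <-|apply: contraNneq h1 => <-].
Qed.

(* Exchanging the labels r and r+1 either exchanges them in the result of the
   pass or, when the pass compares the two, does not change the result. *)
Lemma bub_swap r O x : uniq (x :: O) ->
  let f := swap_succ r in
  (bmin (map f O) (f x) = f (bmin O x) /\
   bout (map f O) (f x) = map f (bout O x)) \/
  [/\ bmin (map f O) (f x) = bmin O x, bout (map f O) (f x) = bout O x,
      r \in x :: O & r.+1 \in x :: O].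
Proof.
move=> + f; elim: O x => [|y O IH] x; first by left.
rewrite /= inE negb_or => /andP[/andP[xy xO] /andP[yO uO]].
have [C|C] := boolP ((x == r) && (y == r.+1) || (x == r.+1) && (y == r)).
  right.
  have [rO r1O] : r \notin O /\ r.+1 \notin O.
    by case/orP: C xO yO => /andP[/eqP-> /eqP->].
  have [-> ->] : minn (f x) (f y) = minn x y /\ maxn (f x) (f y) = maxn x y.
    by rewrite /f /swap_succ; move: C; do ![case: eqP]; lia.
  rewrite map_swap_id //; split => //; rewrite !inE; move: C; lia.
have [-> ->] : minn (f x) (f y) = f (minn x y) /\ maxn (f x) (f y) = f (maxn x y).
  by rewrite /f /swap_succ; move: C; do ![case: eqP]; lia.
have uM : uniq (minn x y :: O).
  by rewrite /= uO andbT; case: (leqP x y).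
case: (IH _ uM) => [[-> ->]|[-> -> hr hr1]]; first by left.
have MO : maxn x y \notin minn x y :: O.
  rewrite inE negb_or; case: (leqP x y) => h; rewrite ?yO ?xO andbT //.
  by rewrite eq_sym.
have [Mr Mr1] : maxn x y != r /\ maxn x y != r.+1.
  by split; apply: contraNneq MO => ->.
right; split => //.
- by rewrite /f /swap_succ (negbTE Mr) (negbTE Mr1).
- by move: hr; rewrite !inE; case: (leqP x y) => _ /orP[]->; rewrite ?orbT.
- by move: hr1; rewrite !inE; case: (leqP x y) => _ /orP[]->; rewrite ?orbT.
Qed.

(** The two runs are related by the exchange until [r] and [r.+1] are compared, and coincide
    afterwards. The comparison cannot be missed, because [r.+1] has entered by the pass that emits
    [r]. *)
Lemma run_swap r t O s : t <= r -> r - t < size s ->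
  r.+1 \in O ++ take (r - t).+1 s -> run O s = iota t (size (O ++ s)) ->
  run (map (swap_succ r) O) (map (swap_succ r) s) = iota t (size (O ++ s)).
Proof.
elim: s t O => [//|x s IH] t O tr szs r1in E.
have uOs : uniq (x :: O ++ s).
  rewrite -cat_cons -(perm_uniq (_ : perm_eq (O ++ x :: s) _)); last first.
    by rewrite (perm_catCA O [:: x] s).
  by rewrite -(perm_uniq (perm_run _ _)) E iota_uniq.
move: (uOs); rewrite -cat_cons cat_uniq => /and3P[uO /hasPn/= sO _].
have r_in : r \in x :: O ++ take (r - t) s.
  have := run_iota_mem E szs.
  by rewrite subnKC //= !(mem_cat, inE) orbCA orbA.
have {}r1in : r.+1 \in x :: O ++ take (r - t) s.
  by move: r1in; rewrite /= !(mem_cat, inE) orbCA orbA.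
move: E; rewrite /= size_cat /= addnS => -[Em Er].
have same : r \in x :: O -> r.+1 \in x :: O ->
    map (swap_succ r) s = s.
  by move=> h h1; apply: map_swap_id; [apply: contraL h|apply: contraL h1];
     apply: sO.
case: (bub_swap r uO) => [[Ef Eo]|[-> -> h h1]]; last first.
  by rewrite same // Em Er.
rewrite Eo Ef Em; move: tr; rewrite leq_eqVlt => /orP[/eqP tr|tr].
  (* Without a comparison the pass for [r] would emit [r.+1] after the exchange, although the
     exchanged window contains [r], the image of [r.+1]. *)
  have : bmin (map (swap_succ r) O) (swap_succ r x) <= r.
    apply: bmin_le; rewrite -map_cons; apply/mapP; exists r.+1.
      by move: r1in; rewrite tr subnn take0 cats0.
    by rewrite /swap_succ eqxx; case: eqP; lia.
  by rewrite Ef Em tr /swap_succ eqxx ltnn.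
have -> : swap_succ r t = t by rewrite /swap_succ !ifN //; lia.
congr cons.
have szE : size O + size s = size (bout O x ++ s) by rewrite size_cat size_bout.
(* The emitted letter is [t < r], so [r.+1] is still available to the later passes. *)
have m1 : r.+1 != bmin O x by rewrite Em; lia.
have rt : r - t = (r - t.+1).+1 by lia.
rewrite szE; apply: IH; rewrite -?szE //; first by move: szs => /=; lia.
move: r1in; rewrite rt -cat_cons mem_cat -mem_bub inE (negbTE m1) /=.
by rewrite mem_cat.
Qed.

(** * Counting sorted words *)

Definition sorts (p : nat) (w : seq nat) : bool :=
  run (rev (take p w)) (drop p w) == iota 1 (size w).

Definition words (N : nat) : seq (seq nat) := permutations (iota 1 N).

Definition insert (j q : nat) (v : seq nat) : seq nat :=
  take q (map (bump j) v) ++ j :: drop q (map (bump j) v).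

Lemma size_insert j q v : size (insert j q v) = (size v).+1.
Proof.
by rewrite size_cat /= addnS -size_cat cat_take_drop size_map.
Qed.

Lemma words_size N w : w \in words N -> size w = N.
Proof. by rewrite mem_permutations => /perm_size ->; rewrite size_iota. Qed.

Lemma words_uniq N w : w \in words N -> uniq w.
Proof. by rewrite mem_permutations => /perm_uniq ->; rewrite iota_uniq. Qed.

Lemma words_mem N w k : w \in words N -> (k \in w) = (1 <= k <= N).
Proof. by rewrite mem_permutations => /perm_mem ->; rewrite mem_iota ltnS. Qed.

Lemma perm_iota_bump j N : 1 <= j <= N.+1 ->
  perm_eq (iota 1 N.+1) (j :: map (bump j) (iota 1 N)).
Proof.
move=> jN; apply: uniq_perm; first exact: iota_uniq.
  rewrite /= (map_inj_uniq (@bump_inj j)) iota_uniq andbT.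
  by apply/mapP => -[k _ /eqP]; rewrite (negbTE (neq_bump j k)).
move=> k; rewrite mem_iota in_cons.
have [->|kj] /= := eqVneq k j; first by lia.
apply/idP/mapP => [kN|[i + ->]]; last by rewrite mem_iota /bump; lia.
by exists (unbump j k); rewrite ?unbumpK // mem_iota /unbump; lia.
Qed.

Lemma perm_insert j q v : perm_eq (insert j q v) (j :: map (bump j) v).
Proof. by rewrite perm_catC /= perm_cons perm_catC cat_take_drop. Qed.

Lemma nth_insert j q v : q <= size v -> nth 0 (insert j q v) q = j.
Proof.
move=> qv; have sz : size (take q (map (bump j) v)) = q.
  by rewrite size_takel // size_map.
by rewrite nth_cat sz ltnn subnn.
Qed.

Lemma insert_inj j q : injective (insert j q).
Proof.
move=> v1 v2 E.
have sz : size v1 = size v2.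
  by have /(f_equal size) := E; rewrite !size_insert => -[].
apply/(inj_map (@bump_inj j)).
move/eqP: E; rewrite /insert eqseq_cat; last by rewrite !size_take !size_map sz.
rewrite eqseq_cons eqxx => /andP[/eqP e1 /eqP e2].
by rewrite -(cat_take_drop q (map _ v1)) e1 e2 cat_take_drop.
Qed.

(** The inverse of the insertion deletes the letter at index [q] and closes the gap in the labels
    with [unbump]. *)
Lemma words_nth j q N : 1 <= j <= N.+1 -> q <= N ->
  perm_eq [seq w <- words N.+1 | nth 0 w q == j] (map (insert j q) (words N)).
Proof.
move=> jN qN; apply: uniq_perm.
- exact/filter_uniq/permutations_uniq.
- by rewrite map_inj_uniq ?permutations_uniq //; apply: insert_inj.
move=> w; rewrite mem_filter; apply/andP/mapP => [[/eqP wq wN]|[v vN ->]].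
  pose l := take q w ++ drop q.+1 w.
  have szw := words_size wN.
  have wE : take q w ++ j :: drop q.+1 w = w.
    by rewrite -wq -drop_nth ?cat_take_drop // szw ltnS.
  have pw : perm_eq w (j :: l).
    by rewrite -{1}wE perm_catC /= perm_cons perm_catC.
  have jl : j \notin l.
    by have := words_uniq wN; rewrite (perm_uniq pw) => /andP[].
  have lE : map (bump j) (map (unbump j) l) = l.
    rewrite -map_comp -[RHS]map_id; apply/eq_in_map => k kl.
    by apply: unbumpK; rewrite inE; apply: contraNneq jl => <-.
  exists (map (unbump j) l).
    rewrite mem_permutations; apply: (perm_map_inj (@bump_inj j)).
    rewrite lE -(perm_cons j) perm_sym -(permPl (perm_iota_bump jN)) perm_sym.
    by move: wN; rewrite mem_permutations (permPl pw).
  have sq : size (take q w) = q by rewrite size_takel // szw ltnW.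
  by rewrite /insert lE take_size_cat ?drop_size_cat.
have szv := words_size vN; split; first by rewrite nth_insert ?szv.
rewrite mem_permutations (permPl (perm_insert _ _ _)) perm_sym.
rewrite (permPl (perm_iota_bump jN)) perm_cons perm_sym.
by apply: perm_map; rewrite -mem_permutations.
Qed.

Lemma count_words_nth (P : pred (seq nat)) j q N : 1 <= j <= N.+1 -> q <= N ->
  count (fun w => (nth 0 w q == j) && P w) (words N.+1) =
  count (fun v => P (insert j q v)) (words N).
Proof.
move=> jN qN; rewrite -[RHS](count_map (insert j q) P).
rewrite -(seq.permP (words_nth jN qN)) count_filter.
by apply: eq_count => w /=; rewrite andbC.
Qed.

(** The number N(n,p,r). Indices start at 0, so index [p] is the first letter after the initial
    window. *)
Definition sorted_words (n p r : nat) : nat :=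
  count (fun w => (nth 0 w p == r) && sorts p w) (words n.+1).

(** At index [p] the letter 1 is the first to enter the window, and the first pass emits it
    immediately. *)
Lemma sorts_insert1 p v : p <= size v -> sorts p (insert 1 p v) = sorts p v.
Proof.
move=> pv; rewrite /sorts size_insert /insert.
have sz : size (take p (map (bump 1) v)) = p by rewrite size_takel // size_map.
by rewrite take_size_cat // drop_size_cat // -map_take -map_drop -map_rev
  run_insert_head.
Qed.

(** The letter at index [p + r] enters in pass [r.+1], so this is [run_insert] with [t = 1] and [s1]
    the [r] letters after the initial window. *)
Lemma sorts_insert p r v : 0 < r -> p + r <= size v ->
  sorts p (insert r.+1 (p + r) v) = sorts p v.
Proof.
move=> r0 prv; rewrite /sorts size_insert /insert.
set f := bump _.
have -> : take (p + r) (map f v) = map f (take p v) ++ map f (take r (drop p v)).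
  by rewrite -map_cat -takeD map_take.
have sz : size (map f (take p v)) = p.
  by rewrite size_map size_takel //; lia.
rewrite -catA take_size_cat // drop_size_cat // -map_drop -map_rev.
rewrite run_insert //; last by rewrite size_takel ?size_drop; lia.
by rewrite addnC -drop_drop cat_take_drop.
Qed.


Lemma sum_count_fibers (T : eqType) (h : T -> nat) (P : pred T) a b (L : seq T) :
  {in L, forall w, a <= h w < b} ->
  \sum_(a <= i < b) count (fun w => (h w == i) && P w) L = count P L.
Proof.
elim: L => [|w L IH] hL /=; first by rewrite big1.
rewrite big_split /= IH => [|u uL]; last by apply: hL; rewrite inE uL orbT.
congr (_ + _); transitivity (\sum_(a <= i < b | i == h w) P w : nat).
  by rewrite [RHS]big_mkcond; apply: eq_bigr => i _; rewrite eq_sym; case: eqP.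
by rewrite big_nat1_eq hL // mem_head.
Qed.

(** Deleting the letter 1 leaves an arbitrary sorted word on [n] letters. These are classified by
    the letter at index [p], which exists because [p < n]. *)
Lemma sorted_words1 n p : p < n ->
  sorted_words n p 1 = \sum_(1 <= i < n.+1) sorted_words n.-1 p i.
Proof.
case: n => // n pn; rewrite /sorted_words count_words_nth //; last exact: ltnW.
rewrite /= (@eq_in_count _ _ (sorts p)); last first.
  by move=> v vN; rewrite sorts_insert1 // (words_size vN) ltnW.
rewrite sum_count_fibers // => w wN.
by rewrite ltnS -(words_mem _ wN) mem_nth // (words_size wN).
Qed.

Lemma words_swap r N : 0 < r < N ->
  perm_eq (map (map (swap_succ r)) (words N)) (words N).
Proof.
move=> rN; have f_inj := inv_inj (swap_succK r).
apply: uniq_perm.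
- rewrite map_inj_uniq ?permutations_uniq //; exact: inj_map.
- exact: permutations_uniq.
have fN w : w \in words N -> map (swap_succ r) w \in words N.
  move=> wN; rewrite mem_permutations; apply: uniq_perm.
  - by rewrite map_inj_uniq // (words_uniq wN).
  - exact: iota_uniq.
  move=> k; rewrite -{1}[k](swap_succK r) mem_map // (words_mem _ wN) mem_iota.
  by rewrite /swap_succ; do ![case: eqP]; lia.
move=> w; apply/mapP/idP => [[v vN ->]|wN]; first exact: fN.
exists (map (swap_succ r) w); first exact: fN.
by rewrite mapK //; apply: swap_succK.
Qed.

Lemma sorts_mem p r N w : w \in words N -> 0 < r -> p + r <= N -> sorts p w ->
  r \in rev (take p w) ++ take r (drop p w).
Proof.
move=> wN r0 prN /eqP E; have szw := words_size wN.
have := @run_iota_mem 1 (rev (take p w)) (drop p w) r.-1.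
rewrite E size_cat size_rev -size_cat cat_take_drop add1n prednK //.
by apply => //; rewrite size_drop szw; lia.
Qed.

(** By [sorts_mem] for [r.+1], this letter has index at most [p + r]. With [p + r] itself excluded,
    it has entered by pass [r], as [run_swap] requires. *)
Lemma sorts_swap p r N w : w \in words N -> 0 < r -> p + r < N -> sorts p w ->
  nth 0 w (p + r) != r.+1 -> sorts p (map (swap_succ r) w).
Proof.
move=> wN r0 prN sw nw; have szw := words_size wN.
rewrite /sorts -map_take -map_drop -map_rev size_map.
have sz : size w = size (rev (take p w) ++ drop p w).
  by rewrite size_cat size_rev -size_cat cat_take_drop.
apply/eqP; rewrite sz; apply: run_swap => //.
- by rewrite size_drop szw; lia.
- rewrite subn1 prednK //.
  have := @sorts_mem p r.+1 N w wN isT; rewrite addnS => /(_ prN sw).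
  rewrite (take_nth 0) ?size_drop ?szw; last by lia.
  by rewrite nth_drop -cats1 catA mem_cat mem_seq1 eq_sym (negbTE nw) orbF.
by rewrite -sz; apply/eqP.
Qed.

(** A letter at index [p + r] or later enters only after pass [r], too late for [r] to be emitted in
    its turn. *)
Lemma sorts_nth p r N w q : w \in words N -> 0 < r -> p + r <= q -> q < N ->
  sorts p w -> nth 0 w q != r.
Proof.
move=> wN r0 prq qN sw; have szw := words_size wN.
have := sorts_mem wN r0 (ltnW (leq_ltn_trans prq qN)) sw.
rewrite mem_cat mem_rev -mem_cat -takeD.
apply: contraTneq => wq; rewrite -[X in X \in _]wq in_take ?mem_nth ?szw //.
by rewrite index_uniq ?szw ?(words_uniq wN) // -leqNgt.
Qed.

Lemma sorted_wordsS n p r : 0 < r -> p + r <= n ->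
  sorted_words n p r = sorted_words n p r.+1 + sorted_words n.-1 p r.
Proof.
case: n => [|n] r0 prn; first by lia.
(* [A] singles out the words in which [r.+1] enters exactly in pass [r.+1]. The others correspond to
   [sorted_words n p r.+1] by the exchange. *)
pose A w := nth 0 w (p + r) == r.+1.
rewrite [LHS]/sorted_words -size_filter -(count_predC A) !count_filter addnC.
congr (_ + _).
  have := words_swap (_ : 0 < r < n.+2); rewrite r0 => /(_ ltac:(lia)) pw.
  rewrite [RHS]/sorted_words -[RHS](seq.permP pw) count_map; apply: eq_in_count => w wN /=.
  have szw := words_size wN.
  have nthS q : q < n.+2 -> nth 0 (map (swap_succ r) w) q = swap_succ r (nth 0 w q).
    by move=> qn; rewrite (nth_map 0) // szw.
  have wN' : map (swap_succ r) w \in words n.+2 by rewrite -(perm_mem pw) map_f.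
  rewrite nthS; last by lia.
  have -> : (swap_succ r (nth 0 w p) == r.+1) = (nth 0 w p == r).
    by rewrite /swap_succ; do ![case: eqP]; lia.
  case: eqP => [wp|]; last by rewrite andbF.
  rewrite /= /A; apply/andP/idP => [[nw sw]|sw].
    by apply: (sorts_swap wN r0 _ sw nw); lia.
  (* The exchanged word is sorted, so it does not have [r] at index [p + r]. *)
  have nw : nth 0 w (p + r) != r.+1.
    have := @sorts_nth p r _ _ (p + r) wN' r0 (leqnn _) _ sw.
    rewrite nthS; last by lia.
    rewrite /swap_succ; do ![case: eqP]; lia.
  split => //.
  (* The exchange is undone by a second one. Its side condition is that [w] does not have [r] at
     index [p + r], which holds because [r] sits at index [p]. *)
  rewrite -[w](mapK (swap_succK r)); apply: (sorts_swap wN' r0 _ sw); first by lia.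
  rewrite nthS; last by lia.
  have : nth 0 w (p + r) != nth 0 w p.
    by rewrite nth_uniq ?szw ?(words_uniq wN) //; lia.
  by rewrite wp /swap_succ; do ![case: eqP]; lia.
(* For words in [A] the letter [r.+1] is deleted. The letter [r] at the earlier index [p] keeps its
   index and label. *)
rewrite /= (@count_words_nth (fun w => (nth 0 w p == r) && sorts p w)) //; [|lia..].
apply: eq_in_count => v vN; have szv := words_size vN.
rewrite sorts_insert ?szv // /insert nth_cat size_takel ?size_map ?szv //.
rewrite ifT; last by lia.
rewrite nth_take; last by lia.
rewrite (nth_map 0) ?szv; last by lia.
by congr (_ && _); rewrite /bump; lia.
Qed.

(** Induction on [r]: by [sorted_wordsS] each increment of [r] removes the first term of the sum,
    starting from [sorted_words1]. *)
Lemma sorted_words_sum n p r : 0 < r -> r + p <= n.+1 -> p < n ->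
  sorted_words n p r = \sum_(r <= i < n.+1) sorted_words n.-1 p i.
Proof.
move=> r0 rp pn; elim: r r0 rp => [//|r IH] _ rp.
case: r IH rp => [|r] IH rp; first exact: sorted_words1.
apply: (@addIn (sorted_words n.-1 p r.+1)).
rewrite -sorted_wordsS //; last by lia.
rewrite IH //; last by lia.
by rewrite addnC -big_ltn //; lia.
Qed.

(** * Confluence of toppling *)

(** Toppling site [i] raises this count by 1 at [i - 1], lowers it by 1 at [i] and changes no other
    value. *)
Definition cumul (m : nat) (c : config) (j : nat) : nat :=
  count (fun k => (c k <= j%:Z)%R) (iota 1 m.+1).

(* In terms of the number of chips per site: the sites of 0..m+1 that do not
   hold exactly one chip alternately hold 0 and 2 chips, starting with 0. *)
Definition balanced (m : nat) (c : config) : Prop :=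
  (forall k, 1 <= k <= m.+1 -> (0 <= c k <= m.+1%:Z)%R) /\
  (forall j, j <= m.+1 -> j <= cumul m c j <= j.+1).

Lemma iota_pair m a b : 1 <= a -> a < b -> b <= m.+1 ->
  exists s, perm_eq (iota 1 m.+1) [:: a, b & s] /\ uniq [:: a, b & s].
Proof.
move=> a1 ab bm; exists (rem b (rem a (iota 1 m.+1))).
have pa : perm_eq (iota 1 m.+1) [:: a, b & rem b (rem a (iota 1 m.+1))].
  apply: perm_trans (perm_to_rem (_ : a \in _)) _; first by rewrite mem_iota; lia.
  rewrite perm_cons; apply: perm_to_rem.
  by rewrite mem_rem_uniq ?iota_uniq // !inE mem_iota; lia.
by rewrite -(perm_uniq pa) iota_uniq.
Qed.

(** Two chips on site [i.+1] make the cumulative count jump by at least 2 there, and the bounds of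
    [balanced] leave only the jump from [i] to [i.+2]. Site 0 cannot hold two chips, and [i.+2] is
    at most the number of chips, [m.+1]. *)
Lemma topple_site m c a b : balanced m c -> 1 <= a -> a < b -> b <= m.+1 ->
  c a = c b -> exists i, [/\ c a = i.+1, i < m, cumul m c i = i &
    cumul m c i.+1 = i.+2].
Proof.
move=> [range bal] a1 ab bm cab.
have [s [pe _]] := iota_pair a1 ab bm.
have cumE j : cumul m c j = (c a <= j%:Z)%R + ((c b <= j%:Z)%R + count (fun k => (c k <= j%:Z)%R) s).
  by rewrite /cumul (seq.permP pe).
have am : 1 <= a <= m.+1 by lia.
have := range a am.
case Ea: (c a) => [i|i]; last by lia.
move=> im.
have mono j : count (fun k => (c k <= j%:Z)%R) s <= count (fun k => (c k <= j.+1%:Z)%R) s.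
  by apply: sub_count => k /=; lia.
have := cumE i; rewrite -cab Ea lexx.
case: i Ea im => [|i] Ea im.
  have := bal 0 isT; lia.
have := cumE i; rewrite -cab Ea.
have -> : (i.+1%:Z <= i%:Z)%R = false by lia.
have := bal i; have := bal i.+1; have := mono i => h2 h3 h4 h5.
have im' : i < m.+1 by lia.
have {}h3 := h3 im'.
have {}h4 := h4 (ltnW im').
have : cumul m c i.+1 <= m.+1.
  by have := count_size (fun k => (c k <= i.+1%:Z)%R) (iota 1 m.+1); rewrite size_iota.
by exists i; split; [by []|lia..].
Qed.

(** The counts [i] and [i.+2] found by [topple_site] both become [i.+1], which respects the bounds
    at [i] and at [i.+1]. *)
Lemma topple_balanced m c c' : balanced m c -> topple m c c' -> balanced m c'.
Proof.
move=> bal [a [b [a1 ab bm cab c'E]]].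
have [i [Ea im ci ci1]] := topple_site bal a1 ab bm cab.
case: bal => range bal.
have [s [pe us]] := iota_pair a1 ab bm.
have c'a : c' a = i by rewrite c'E eqxx Ea; lia.
have c'b : c' b = i.+2 by rewrite c'E eqxx Ea; case: eqP; lia.
have cumE (d : config) j : cumul m d j =
    (d a <= j%:Z)%R + ((d b <= j%:Z)%R + count (fun k => (d k <= j%:Z)%R) s).
  by rewrite /cumul (seq.permP pe).
split=> [k km|j jm].
  rewrite c'E; have := range k km; case: eqP => ? ; first by lia.
  by case: eqP; lia.
have := bal j jm; have := cumE c j; rewrite (cumE c').
have -> : count (fun k => (c' k <= j%:Z)%R) s = count (fun k => (c k <= j%:Z)%R) s.
  apply: eq_in_count => k ks; rewrite c'E !ifN //.
    by apply: contraTneq ks => ->; case/and3P: us.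
  by apply: contraTneq ks => ->; case/andP: us => /norP[].
rewrite c'a c'b -cab Ea.
have [ji|ji] := eqVneq j i.
  by subst j; rewrite ci; lia.
have [ji1|ji1] := eqVneq j i.+1.
  by subst j; rewrite ci1; lia.
lia.
Qed.

(** A third chip would make the cumulative count jump by 3. *)
Lemma two_chips m c a b d : balanced m c -> 1 <= a -> a < b -> b <= m.+1 ->
  c a = c b -> 1 <= d <= m.+1 -> c d = c a -> d = a \/ d = b.
Proof.
move=> bal a1 ab bm cab dm cda.
have [i [Ea im ci ci1]] := topple_site bal a1 ab bm cab.
have [->|da] := eqVneq d a; first by left.
have [->|db] := eqVneq d b; first by right.
have [s [pe us]] := iota_pair a1 ab bm.
have ds : d \in s.
  have := perm_mem pe d; rewrite mem_iota !inE (negbTE da) (negbTE db) /= => <-.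
  by lia.
have cumE j : cumul m c j =
    (c a <= j%:Z)%R + ((c b <= j%:Z)%R + ((c d <= j%:Z)%R + count (fun k => (c k <= j%:Z)%R) (rem d s))).
  by rewrite /cumul (seq.permP pe) /= (seq.permP (perm_to_rem ds)).
have := cumE i; have := cumE i.+1; rewrite ci ci1 cda -cab Ea.
have : count (fun k => (c k <= i%:Z)%R) (rem d s) <= count (fun k => (c k <= i.+1%:Z)%R) (rem d s).
  by apply: sub_count => k /=; lia.
lia.
Qed.

(** Topples at the same site move the same two chips by [two_chips]. Topples at different sites move
    disjoint pairs and commute. *)
Lemma topple_diamond m c c1 c2 : balanced m c -> topple m c c1 -> topple m c c2 ->
  c1 = c2 \/ exists2 d, topple m c1 d & topple m c2 d.
Proof.
move=> bal [a [b [a1 ab bm cab ->]]] [a' [b' [a'1 ab' bm' cab' ->]]].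
have [E|E] := pselect (c a = c a').
  left; have ra' : 1 <= a' <= m.+1 by lia.
  have rb' : 1 <= b' <= m.+1 by lia.
  have hb' : c b' = c a by rewrite E cab'.
  have := two_chips bal a1 ab bm cab ra' (esym E).
  have := two_chips bal a1 ab bm cab rb' hb'.
  move=> h1 h2; have -> : a' = a by lia.
  by have -> : b' = b by lia.
right.
have [n1 n2 n3 n4] : [/\ a <> a', a <> b', b <> a' & b <> b'].
  by split=> e; apply: E; subst; congruence.
exists (fun k => if k == a then (c a - 1)%R else if k == b then (c a + 1)%R
  else if k == a' then (c a' - 1)%R else if k == b' then (c a' + 1)%R else c k).
- exists a', b'; split => //; first by do ![case: eqP => [?|_]]; try congruence.
  apply/funext => k.
  by do ![case: eqP => [?|_]]; try congruence.
- exists a, b; split => //; first by do ![case: eqP => [?|_]]; try congruence.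
  apply/funext => k.
  by do ![case: eqP => [?|_]]; try congruence.
Qed.

Lemma stable_no_topple m c c' : stable m c -> ~ topple m c c'.
Proof. by move=> st [a [b [a1 ab bm cab _]]]; apply: (st a b). Qed.

(** Induction along the path to [z]: the diamond carries the step to [c1] across each step of that
    path. *)
Lemma topple_normal m c c1 z : balanced m c ->
  clos_refl_trans config (topple m) c z -> stable m z -> topple m c c1 ->
  clos_refl_trans config (topple m) c1 z.
Proof.
move=> bal /clos_rt_rt1n_iff cz st; elim: cz bal st c1 => {c z} [z|c c2 z] .
  by move=> _ st c1 /(stable_no_topple st).
move=> cc2 c2z IH bal st c1 cc1.
have bal2 := topple_balanced bal cc2.
case: (topple_diamond bal cc1 cc2) => [->|[d c1d c2d]].
  by apply/clos_rt_rt1n_iff.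
by apply: rt_trans (rt_step _ _ _ _ c1d) (IH bal2 st _ c2d).
Qed.

Lemma final_unique m c z1 z2 : balanced m c ->
  final m c z1 -> final m c z2 -> z1 = z2.
Proof.
move=> bal [cz1 st1] [/clos_rt_rt1n_iff cz2 st2].
elim: cz2 bal cz1 st2 => {c z2} [z|c c2 z2 cc2 _ IH] bal cz1 st2.
  case/clos_rt_rt1n_iff: cz1 => // y w zy _.
  by case: (stable_no_topple st2 zy).
apply: IH => //; first exact: topple_balanced cc2.
exact: topple_normal cz1 st1 cc2.
Qed.

(** * Stabilization by bubble passes *)

(* [O] lists, from right to left, the chips on the sites t+1, ..., t + size O. *)
Fixpoint descending (c : config) (t : nat) (O : seq nat) : Prop :=
  if O is y :: O' then c y = (t + size O)%N /\ descending c t O' else True.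

Fixpoint ascending (c : config) (t : nat) (s : seq nat) : Prop :=
  if s is x :: s' then c x = t /\ ascending c t.+1 s' else True.

Lemma eq_descending c c' t O : {in O, c =1 c'} -> descending c t O -> descending c' t O.
Proof.
elim: O => //= y O IH e [cy cO]; rewrite -e ?mem_head //; split=> //.
by apply: IH => // k kO; apply: e; rewrite inE kO orbT.
Qed.

Lemma eq_ascending c c' t s : {in s, c =1 c'} -> ascending c t s -> ascending c' t s.
Proof.
elim: s t => //= x s IH t e [cx cs]; rewrite -e ?mem_head //; split=> //.
by apply: IH => // k ks; apply: e; rewrite inE ks orbT.
Qed.

Lemma map_ascending c t s : ascending c t s -> map c s = map Posz (iota t (size s)).
Proof. by elim: s t => //= x s IH t [-> /IH ->]. Qed.

Lemma map_descending c t O : descending c t O ->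
  map c (rev O) = map Posz (iota t.+1 (size O)).
Proof.
elim: O => [//|y O IH] [cy /IH e].
by rewrite rev_cons map_rcons e cy -[size (y :: O)]addn1 iotaD map_cat cats1 addSnnS addn1.
Qed.

Lemma topple_pair m (c : config) x y i : 1 <= x <= m.+1 -> 1 <= y <= m.+1 -> x != y ->
  c x = i.+1 -> c y = i.+1 ->
  exists c' : config, [/\ topple m c c', c' (minn x y) = i, c' (maxn x y) = i.+2 &
    forall k, k != x -> k != y -> c' k = c k].
Proof.
move=> xm ym xy cx cy.
have cmin : c (minn x y) = i.+1 by case: leqP.
have cmax : c (maxn x y) = i.+1 by case: leqP.
have mm : minn x y < maxn x y by move: xy; lia.
exists (fun k => if k == minn x y then (c (minn x y) - 1)%R else
  if k == maxn x y then (c (minn x y) + 1)%R else c k); split.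
- by exists (minn x y), (maxn x y); split => //; [lia|lia|rewrite cmin cmax].
- by rewrite eqxx cmin; lia.
- by rewrite eqxx cmin ifN; lia.
- by move=> k kx ky; rewrite !ifN //; move: kx ky; case: leqP.
Qed.

(** Each comparison of the pass is one topple: the larger chip moves right to its final place in
    this pass, and the smaller moves left onto the site of the next letter of [O]. *)
Lemma pass_topples m O x (c : config) t : uniq (x :: O) ->
  {in x :: O, forall k, 1 <= k <= m.+1} ->
  descending c t O -> c x = (t + size O)%N ->
  exists c', [/\ clos_refl_trans config (topple m) c c', c' (bmin O x) = t,
    descending c' t.+1 (bout O x) & forall k, k \notin x :: O -> c' k = c k].
Proof.
elim: O x c => [|y O IH] x c /=.
  by move=> _ _ _; rewrite addn0 => cx; exists c; split => //; apply: rt_refl.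
rewrite inE negb_or => /andP[/andP[xy xO] /andP[yO uO]] range [cy cO] cx.
have xm : 1 <= x <= m.+1 by apply: range; rewrite mem_head.
have ym : 1 <= y <= m.+1 by apply: range; rewrite !inE eqxx orbT.
have cx' : c x = (t + size O).+1 by rewrite cx addnS.
have cy' : c y = (t + size O).+1 by rewrite cy addnS.
have [c1 [cc1 c1min c1max c1E]] := topple_pair xm ym xy cx' cy'.
have memO k : k \in O -> k != x /\ k != y.
  by move=> kO; split; apply: contraTneq kO => ->.
have uM : uniq (minn x y :: O) by rewrite /= uO andbT; case: leqP.
have rangeM : {in minn x y :: O, forall k, 1 <= k <= m.+1}.
  move=> k; rewrite inE => /orP[/eqP ->|kO]; first by lia.
  by apply: range; rewrite !inE kO !orbT.
have c1O : descending c1 t O.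
  by apply: eq_descending cO => k /memO[kx ky]; rewrite c1E //.
have [c' [c1c' c'min c'O c'E]] := IH _ _ uM rangeM c1O c1min.
have MO : maxn x y \notin minn x y :: O.
  rewrite inE negb_or; case: (leqP x y) => h; rewrite ?yO ?xO andbT //.
  by rewrite eq_sym.
exists c'; split => //.
- by apply: rt_trans (rt_step _ _ _ _ cc1) c1c'.
- by rewrite /= size_bout; split => //; rewrite c'E // c1max; congr Posz; lia.
move=> k; rewrite !inE !negb_or => /and3P[kx ky kO].
rewrite c'E ?c1E // inE negb_or kO andbT.
by case: leqP.
Qed.

(** The head of [O] and the head of [s] share the site [t + size O]. A pass shifts the window by one
    site, so the next letter of [s] again meets the rightmost chip. The site [t + size s] is the gap
    in the final positions. *)
Lemma run_topples m O s c t : uniq (O ++ s) ->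
  {in O ++ s, forall k, 1 <= k <= m.+1} ->
  descending c t O -> ascending c (t + size O) s ->
  exists c', [/\ clos_refl_trans config (topple m) c c',
    map c' (run O s) = map Posz (iota t (size s) ++ iota (t + size s).+1 (size O)) &
    forall k, k \notin O ++ s -> c' k = c k].
Proof.
elim: s O c t => [|x s IH] O c t.
  move=> _ _ cO _; exists c; split => //=; first exact: rt_refl.
  by rewrite addn0 (map_descending cO).
have pX : perm_eq (O ++ x :: s) (x :: O ++ s) by rewrite (perm_catCA O [:: x] s).
rewrite (perm_uniq pX) => u range cO [cx cs].
have := u; rewrite -cat_cons cat_uniq => /and3P[uO /hasPn/= sO us].
have range' : {in x :: O ++ s, forall k, 1 <= k <= m.+1}.
  by move=> k; rewrite -(perm_mem pX); apply: range.
have rangeO : {in x :: O, forall k, 1 <= k <= m.+1}.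
  by move=> k kO; apply: range'; rewrite -cat_cons mem_cat kO.
have [c1 [cc1 c1min c1O c1E]] := pass_topples uO rangeO cO cx.
have pB : perm_eq (bmin O x :: bout O x ++ s) (x :: O ++ s).
  by rewrite -!cat_cons perm_cat2r perm_bub.
have := u; rewrite -(perm_uniq pB) => /andP[minB uB].
have c1s : ascending c1 (t.+1 + size (bout O x)) s.
  rewrite size_bout addSn; apply: eq_ascending cs => k ks.
  by rewrite c1E //; apply: sO.
have rangeB : {in bout O x ++ s, forall k, 1 <= k <= m.+1}.
  by move=> k kB; apply: range'; rewrite -(perm_mem pB) inE kB orbT.
have [c' [c1c' c'run c'E]] := IH _ _ _ uB rangeB c1O c1s.
exists c'; split.
- exact: rt_trans cc1 c1c'.
- by rewrite /= c'run c'E // c1min size_bout addSnnS.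
move=> k; rewrite (perm_mem pX) -(perm_mem pB) inE negb_or => /andP[kB ks].
rewrite c'E // c1E //; apply: contra ks => kO.
have := mem_bub O x k; rewrite kO inE (negbTE kB) /= => h.
by rewrite mem_cat h.
Qed.

Lemma count_le_iota j a n : count (fun k => k <= j) (iota a n) = minn n (j.+1 - a).
Proof. by elim: n a => [|n IH] a /=; rewrite ?IH; lia. Qed.

Lemma start_balanced m c O s : perm_eq (O ++ s) (iota 1 m.+1) -> size O <= m ->
  descending c 0 O -> ascending c (size O) s -> balanced m c.
Proof.
move=> pe szO cO cs.
have szs : size s = m.+1 - size O.
  by have := perm_size pe; rewrite size_cat size_iota; lia.
have pe' : perm_eq (rev O ++ s) (iota 1 m.+1).
  by apply: perm_trans pe; rewrite perm_cat2r perm_rev.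
have cE : map c (rev O ++ s) = map Posz (iota 1 (size O) ++ iota (size O) (size s)).
  by rewrite !map_cat (map_descending cO) (map_ascending cs).
split=> [k km|j jm].
  have : c k \in map c (rev O ++ s).
    by rewrite map_f // (perm_mem pe') mem_iota; lia.
  by rewrite cE => /mapP[i]; rewrite mem_cat !mem_iota szs => + ->; lia.
have -> : cumul m c j = count (fun i => i <= j) (iota 1 (size O) ++ iota (size O) (size s)).
  rewrite /cumul -(seq.permP pe') -(count_map c (fun x => (x <= j%:Z)%R)) cE count_map.
  by apply: eq_count => i /=; lia.
by rewrite count_cat !count_le_iota szs; lia.
Qed.

(** The configuration reached by the passes is stable and reads [run O s] from left to right. By
    uniqueness it is the only final one. *)
Lemma stabilizes_sorted_run m c O s : perm_eq (O ++ s) (iota 1 m.+1) -> size O <= m ->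
  descending c 0 O -> ascending c (size O) s ->
  (exists c', final m c c' /\ reads_identity m c') <-> run O s = iota 1 m.+1.
Proof.
move=> pe szO cO cs; have bal := start_balanced pe szO cO cs.
have szs : size s = m.+1 - size O.
  by have := perm_size pe; rewrite size_cat size_iota; lia.
have u : uniq (O ++ s) by rewrite (perm_uniq pe) iota_uniq.
have range : {in O ++ s, forall k, 1 <= k <= m.+1}.
  by move=> k; rewrite (perm_mem pe) mem_iota; lia.
have [z [cz zrun _]] := run_topples u range cO cs.
set Z := iota 0 _ ++ _ in zrun.
have sortedZ : sorted ltn Z.
  rewrite sorted_pairwise; last exact: ltn_trans.
  rewrite pairwise_cat -!sorted_pairwise ?iota_ltn_sorted; try exact: ltn_trans.
  rewrite !andbT; apply/allrelP => i k; rewrite !mem_iota; lia.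
have prun : perm_eq (run O s) (iota 1 m.+1) := perm_trans (perm_run O s) pe.
have inrun k : 1 <= k <= m.+1 -> k \in run O s.
  by rewrite (perm_mem prun) mem_iota; lia.
have zlt : {in run O s &, forall k l, index k (run O s) < index l (run O s) -> (z k < z l)%R}.
  apply: sorted_ltn_index; first by move=> ? ? ?; apply: lt_trans.
  by rewrite -(sorted_map (f := z) (e' := <%R)) zrun sorted_map.
have stz : stable m z.
  move=> a b a1 ab bm zab.
  have ar : a \in run O s by apply: inrun; lia.
  have br : b \in run O s by apply: inrun; lia.
  have [iab|iab|iab] := ltngtP (index a (run O s)) (index b (run O s)).
  - by have := zlt _ _ ar br iab; rewrite zab ltxx.
  - by have := zlt _ _ br ar iab; rewrite zab ltxx.
  - by move: ab; rewrite -(nth_index 0 ar) iab nth_index // ltnn.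
split=> [[c' [fin [_ incr]]]|E].
  have {fin} c'z : c' = z by apply: final_unique bal fin _.
  (* Sites increase along [run O s], and [z] is increasing in the label, so the word itself is
     increasing. *)
  subst c'; apply: (irr_sorted_eq ltn_trans ltnn).
  - apply: (@sub_in_sorted _ (fun k => 1 <= k <= m.+1) (relpre z <%R)).
    + move=> a b am bm /= zab; rewrite ltnNge leq_eqVlt.
      apply/negP => /orP[/eqP ba|ba]; first by rewrite ba ltxx in zab.
      by have := incr b a; lia.
    + by apply/allP => k; rewrite (perm_mem prun) mem_iota; lia.
    + by rewrite -(sorted_map (f := z) (e' := <%R)) zrun sorted_map.
  - exact: iota_ltn_sorted.
  - exact: perm_mem.
exists z; split => //; split.
  move=> k /inrun kr; have : z k \in map z (run O s) by rewrite map_f.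
  rewrite zrun => /mapP[i + ->]; rewrite mem_cat !mem_iota szs; lia.
move=> a b a1 ab bm.
apply: zlt; [apply: inrun; lia|apply: inrun; lia|].
rewrite E; suff iE k : 1 <= k <= m.+1 -> index k (iota 1 m.+1) = k.-1.
  by rewrite !iE; lia.
move=> km; have {1}-> : k = nth 0 (iota 1 m.+1) k.-1 by rewrite nth_iota; lia.
by rewrite index_uniq ?iota_uniq // size_iota; lia.
Qed.

(** * Permutations and reflection *)

Definition perm_word (m : nat) (pi : 'S_m) : seq nat :=
  [seq (pi i).+1 | i <- enum 'I_m].

Lemma size_perm_word m (pi : 'S_m) : size (perm_word pi) = m.
Proof. by rewrite size_map size_enum_ord. Qed.

Lemma nth_perm_word m (pi : 'S_m) (i : 'I_m) : nth 0 (perm_word pi) i = (pi i).+1.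
Proof. by rewrite (nth_map i) ?size_enum_ord // nth_ord_enum. Qed.

Lemma perm_word_words m (pi : 'S_m) : perm_word pi \in words m.
Proof.
rewrite mem_permutations; apply: uniq_perm; last 1 first.
- move=> k; rewrite mem_iota; apply/mapP/idP => [[i _ ->]|km].
    by have := ltn_ord (pi i); lia.
  have km' : k.-1 < m by lia.
  exists ((pi^-1)%g (Ordinal km')); first by rewrite mem_enum.
  by rewrite permKV /=; lia.
- by rewrite map_inj_uniq ?enum_uniq // => i j [/val_inj/perm_inj].
- exact: iota_uniq.
Qed.

Lemma perm_words_enum m : perm_eq (map (@perm_word m) (enum {: 'S_m})) (words m).
Proof.
apply: uniq_perm; last 1 first.
- move=> v; apply/mapP/idP => [[pi _ ->]|vm]; first exact: perm_word_words.
  have szv := words_size vm.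
  have v_range i : i < m -> 1 <= nth 0 v i <= m.
    by move=> im; rewrite -(words_mem _ vm) mem_nth ?szv.
  have vP (i : 'I_m) : (nth 0 v i).-1 < m.
    by have := v_range i (ltn_ord i); lia.
  have v_inj : injective (fun i => Ordinal (vP i)).
    move=> i j /(f_equal val) /= e; apply: val_inj => /=; apply/eqP.
    rewrite -(nth_uniq 0 _ _ (words_uniq vm)) ?szv //.
    have /andP[hi _] := v_range i (ltn_ord i).
    have /andP[hj _] := v_range j (ltn_ord j).
    by rewrite -(prednK hi) e prednK.
  exists (perm v_inj); first by rewrite mem_enum.
  apply: (@eq_from_nth _ 0); first by rewrite size_perm_word.
  move=> i; rewrite szv => im; rewrite (nth_perm_word _ (Ordinal im)) permE /=.
  by have := v_range i im; lia.
- rewrite map_inj_uniq ?enum_uniq // => pi1 pi2 e.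
  apply/permP => i; apply: val_inj; apply: succn_inj.
  by rewrite -!nth_perm_word e.
- exact: permutations_uniq.
Qed.

Lemma ascending_nth (c : config) t s :
  (forall i, i < size s -> c (nth 0 s i) = (t + i)%N) -> ascending c t s.
Proof.
elim: s t => //= x s IH t H; split; first by rewrite (H 0) // addn0.
by apply: IH => i si; rewrite (H i.+1) // addSnnS.
Qed.

Lemma descending_nth (c : config) t s :
  (forall i, i < size s -> c (nth 0 s i) = (t + i).+1) -> descending c t (rev s).
Proof.
elim/last_ind: s => // s x IH H; rewrite rev_rcons /= size_rev; split.
  have := H (size s); rewrite size_rcons nth_rcons ltnn eqxx => -> //.
  by rewrite addnS.
apply: IH => i si; have := H i; rewrite size_rcons nth_rcons si; apply.
exact: ltnW.
Qed.

Definition stabilizes_sorted (m : nat) (c : config) : Prop :=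
  exists c', final m c c' /\ reads_identity m c'.

(** Only the positions of the chips 1, ..., [m.+1] are prescribed, so this applies to a reflected
    [init], which can differ from an [init] on irrelevant labels. Chip [r] comes right after the
    first [p] letters, sharing site [p] with the last of them. *)
Lemma stabilizes_sortedP m r p (pi : 'S_m) (c : config) :
  1 <= p <= m -> 1 <= r <= m.+1 -> c r = p ->
  (forall i, c (bump r (pi i).+1) = i.+1) ->
  stabilizes_sorted m c <-> sorts p (insert r p (perm_word pi)).
Proof.
move=> pm rm cr cpi; set v := perm_word pi; set w := insert r p v.
have szv : size (map (bump r) v) = m by rewrite size_map size_perm_word.
have szT : size (take p (map (bump r) v)) = p by rewrite size_takel ?szv; lia.
have szw : size w = m.+1 by rewrite size_insert size_perm_word.
have Tw : take p w = take p (map (bump r) v) by rewrite take_size_cat.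
have Dw : drop p w = r :: drop p (map (bump r) v) by rewrite drop_size_cat.
have cv i : i < m -> c (nth 0 (map (bump r) v) i) = i.+1.
  move=> im; rewrite (nth_map 0) ?size_perm_word //.
  by rewrite (nth_perm_word pi (Ordinal im)) cpi.
have pw : perm_eq w (iota 1 m.+1).
  rewrite (permPl (perm_insert _ _ _)) perm_sym (permPl (perm_iota_bump rm)).
  rewrite perm_cons perm_map // perm_sym -mem_permutations.
  exact: perm_word_words.
rewrite /sorts szw; apply: (iff_trans _ (rwP eqP)).
apply: stabilizes_sorted_run.
- by apply: perm_trans pw; rewrite -{3}(cat_take_drop p w) perm_cat2r perm_rev.
- by rewrite size_rev Tw szT; lia.
- apply: descending_nth => i; rewrite Tw szT => ip.
  by rewrite nth_take // cv //; lia.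
- rewrite size_rev Tw szT; apply: ascending_nth => -[|i].
    by rewrite Dw /= cr addn0.
  rewrite Dw /= size_drop szv => im; rewrite nth_drop cv ?addnS //; lia.
Qed.

Lemma init_chip m r p (pi : 'S_m) i : init r p pi (bump r (pi i).+1) = i.+1.
Proof.
rewrite /init ifN; last by rewrite eq_sym neq_bump.
have chipE j : chip_at r pi j = bump r (pi j).+1.
  by rewrite /chip_at /bump; case: leqP.
rewrite (@eq_find _ _ (pred1 i)).
  by rewrite -/(index i _) index_enum_ord.
move=> j /=; rewrite chipE (inj_eq (@bump_inj r)) eqSS.
by rewrite (inj_eq val_inj) (inj_eq perm_inj).
Qed.

Lemma mem_calT m r p (pi : 'S_m) :
  pi \in calT m r p <-> stabilizes_sorted m (init r p pi).
Proof. by rewrite inE; split => /asboolP. Qed.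

Lemma card_calT m r p : 1 <= p <= m -> 1 <= r <= m.+1 ->
  #|calT m r p| = sorted_words m p r.
Proof.
move=> pm rm; rewrite /sorted_words count_words_nth //; last by lia.
rewrite -(seq.permP (perm_words_enum m)) count_map enumT.
rewrite cardE /enum_mem size_filter; apply: eq_count => pi /=.
rewrite -[LHS]/(pi \in calT m r p).
have H : stabilizes_sorted m (init r p pi) <->
    sorts p (insert r p (perm_word pi)).
  by apply: stabilizes_sortedP => //; [rewrite /init eqxx|apply: init_chip].
by apply/idP/idP => [/mem_calT/H|/H/mem_calT].
Qed.

Definition reflect_config (m : nat) (c : config) : config :=
  fun k => (m.+1%:Z - c (m.+2 - k)%N)%R.

(** Reversing both labels and sites preserves the rule that the smaller chip goes left. *)
Lemma topple_reflect m c c' : topple m c c' ->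
  topple m (reflect_config m c) (reflect_config m c').
Proof.
move=> [a [b [a1 ab bm cab ->]]]; exists (m.+2 - b), (m.+2 - a).
rewrite /reflect_config !subKn; [|lia..].
split; [lia|lia|lia|by rewrite cab|].
apply/funext => k.
have -> : (k == m.+2 - b) = (m.+2 - k == b) by lia.
have -> : (k == m.+2 - a) = (m.+2 - k == a) by lia.
case: eqP => [->|_]; case: eqP => [e|_] //; lia.
Qed.

Lemma stabilizes_sorted_reflect m c : stabilizes_sorted m c ->
  stabilizes_sorted m (reflect_config m c).
Proof.
move=> [z [[cz stz] [range incr]]]; exists (reflect_config m z); split; first split.
- elim: cz => {c z stz range incr} [c z /topple_reflect|c|c d z _ IH1 _ IH2].
  + exact: rt_step.
  + exact: rt_refl.
  + exact: rt_trans IH1 IH2.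
- move=> a b a1 ab bm e; apply: (stz (m.+2 - b) (m.+2 - a)); [lia..|].
  by move: e; rewrite /reflect_config; lia.
split=> [k km|a b a1 ab bm]; rewrite /reflect_config.
  have := range (m.+2 - k); have -> : 0 < m.+2 - k <= m.+1 by lia.
  by move=> /(_ isT); lia.
have := incr (m.+2 - b) (m.+2 - a); lia.
Qed.

Lemma mirror_inj m (pi : 'S_m) : injective (fun i => rev_ord (pi (rev_ord i))).
Proof. by move=> i j /rev_ord_inj/perm_inj/rev_ord_inj. Qed.

(** The conjugate of [pi] by the longest element of the symmetric group. *)
Definition mirror m (pi : 'S_m) : 'S_m := perm (@mirror_inj m pi).

Lemma mirrorK m : involutive (@mirror m).
Proof. by move=> pi; apply/permP => i; rewrite !permE !rev_ordK. Qed.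

Lemma calT_mirror m r p (pi : 'S_m) : 1 <= p <= m -> 1 <= r <= m.+1 ->
  pi \in calT m r p -> mirror pi \in calT m (m.+2 - r) (m.+1 - p).
Proof.
move=> pm rm /mem_calT/stabilizes_sorted_reflect st; apply/mem_calT.
have pm' : 1 <= m.+1 - p <= m by lia.
have rm' : 1 <= m.+2 - r <= m.+1 by lia.
(* Both the reflected configuration and the [init] of [mirror pi] are described by the same word,
   which transfers the property between them. *)
have stP c := stabilizes_sortedP (c := c) (pi := mirror pi) pm' rm'.
apply/stP; [by rewrite /init eqxx|exact: init_chip|].
apply/(stP _ _ _).1: st.
  by rewrite /reflect_config subKn ?/init ?eqxx; lia.
move=> i; rewrite permE /reflect_config.
have im := ltn_ord (pi (rev_ord i)).
have -> : m.+2 - bump (m.+2 - r) (rev_ord (pi (rev_ord i))).+1 = bump r (pi (rev_ord i)).+1.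
  by rewrite /bump /=; lia.
by rewrite init_chip /=; have := ltn_ord i; lia.
Qed.

(** Since [mirror] is injective, each side is at most the other: the change of parameters is an
    involution. *)
Lemma card_calT_mirror m r p : 1 <= p <= m -> 1 <= r <= m.+1 ->
  #|calT m r p| = #|calT m (m.+2 - r) (m.+1 - p)|.
Proof.
have le q s : 1 <= q <= m -> 1 <= s <= m.+1 ->
    #|calT m s q| <= #|calT m (m.+2 - s) (m.+1 - q)|.
  move=> qm sm; rewrite -(card_imset _ (can_inj (@mirrorK m))).
  by apply/subset_leq_card/subsetP => _ /imsetP[pi /calT_mirror + ->]; apply.
move=> pm rm; apply/eqP; rewrite eqn_leq le //=.
have := le (m.+1 - p) (m.+2 - r).
by rewrite !subKn; [apply; lia|lia..].
Qed.

Theorem theorem4p8 (n p r : nat) :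
  2 <= n -> 1 <= p <= n -> 1 <= r <= n.+1 ->
  (r <= n - p + 1 -> p <= n - 1 ->
     #|calT n r p| = \sum_(r <= i < n.+1) #|calT n.-1 i p|) /\
  (n - p + 1 < r -> 2 <= p ->
     #|calT n r p| = \sum_(1 <= i < r) #|calT n.-1 i p.-1|).
Proof.
move=> n2.
have left_case q s : 1 <= q <= n -> 1 <= s <= n.+1 -> s <= n - q + 1 -> q <= n - 1 ->
    #|calT n s q| = \sum_(s <= i < n.+1) #|calT n.-1 i q|.
  move=> qn sn sq q1; rewrite card_calT // sorted_words_sum; [|lia..].
  by apply: eq_big_nat => i si; rewrite card_calT //; lia.
move=> pn rn; split; first exact: left_case.
(* The mirrored parameters [n.+2 - r] and [n.+1 - p] satisfy the hypotheses of the first formula. *)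
move=> rp p2; rewrite card_calT_mirror // left_case; [|lia..].
(* Mirroring each term back in size [n.-1] sends label [i] to [n.+1 - i] and site [n.+1 - p] to
   [p.-1], so the summation order is reversed. *)
rewrite [RHS]big_nat_rev /=.
have -> : n.+2 - r = 1 + (n.+1 - r) by lia.
rewrite big_addn subKn; last by lia.
apply: eq_big_nat => i ir; rewrite card_calT_mirror; [|lia..].
congr #|pred_of_set (calT _ _ _)|; lia.
Qed.
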